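(* Let $\Theta$ be a locally compact separable metric space. Let $\{\pi_n\}_n$ be a sequence of proper distributions on $\Theta$ that converges q-vaguely to an improper distribution $\pi^{(1)}$. Then, for any other improper distribution $\pi^{(2)}$ on $\Theta$, there exists a sequence $\{\widetilde\pi_n\}_n$ of proper distributions on $\Theta$ that converges q-vaguely to $\pi^{(2)}$ and that has the same FAP limit points as $\{\pi_n\}_n$.
   Context: Measurability is with respect to the Borel $\sigma$-algebra of $\Theta$. A proper distribution is a countably additive probability measure on $\Theta$. A Radon measure is a regular countably additive positive measure that is finite on every compact set; Radon measures are here assumed non-null. An improper distribution is an unbounded Radon measure, i.e. one with infinite total mass. For a measure $\mu$ write $\mu(f)=\int f\,d\mu$. q-vague convergence: let $\mathcal C_K$ be the set of continuous real-valued functions on $\Theta$ with compact support. A sequence $\{\mu_n\}_n$ of Radon measures converges q-vaguely to a Radon measure $\mu$ if there exist scalars $a_n>0$ such that $a_n\mu_n(f)\to\mu(f)$ for every $f\in\mathcal C_K$. FAP: let $\mathcal F_b$ be the set of bounded real-valued measurable functions on $\Theta$. A finitely additive probability (FAP) is a linear functional $\pi$ on $\mathcal F_b$ which is positive ($\pi(f)\ge 0$ if $f\ge 0$) and satisfies $\pi(1)=1$. Each proper distribution is regarded as a FAP via $f\mapsto\int f\,d\pi$. A FAP $\pi$ is a FAP limit point of a sequence $\{\pi_n\}_n$ of FAPs if it is a limit point for the weak$^*$ topology, i.e. for every integer $p\ge1$, all $f_1,\dots,f_p\in\mathcal F_b$ and every $\varepsilon>0$, there are infinitely many $n$ such that $|\pi_n(f_i)-\pi(f_i)|\le\varepsilon$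 for $i=1,\dots,p$. *)

(* Defs.v *)
From HB Require Import structures.
From mathcomp Require Import all_boot all_order all_algebra.
From mathcomp Require Import all_classical all_reals all_analysis.
From mathcomp Require Import measurable_realfun.

Set Implicit Arguments.
Unset Strict Implicit.
Unset Printing Implicit Defensive.

Import Order.TTheory GRing.Theory Num.Theory.
Import numFieldNormedType.Exports.

Local Open Scope classical_set_scope.
Local Open Scope ring_scope.

(* Measurable types are pointed in the library, so the space must be nonempty;
   a space carrying a measure of nonzero mass always is. *)
#[short(type="pmetricType")]
HB.structure Definition PMetric (R : numDomainType) :=
  {M of Metric R M & Pointed M}.

Definition separable_space (T : topologicalType) : Prop :=
  exists2 D : set T, countable D & dense D.

Notation borel T := (g_sigma_algebraType (@open T)).

Section radon.
Context {R : realType} {T : pmetricType R}.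
Implicit Type mu : {measure set (borel T) -> \bar R}.
Local Open Scope ereal_scope.

Definition outer_regular mu (A : set T) : Prop :=
  mu A = ereal_inf [set mu U | U in [set U : set T | open U /\ A `<=` U]].

Definition inner_regular mu (A : set T) : Prop :=
  mu A = ereal_sup [set mu K | K in [set K : set T | compact K /\ K `<=` A]].

Definition regular_measure mu : Prop :=
  forall A : set (borel T), measurable A ->
    outer_regular mu A /\ inner_regular mu A.

Definition radon mu : Prop :=
  [/\ regular_measure mu,
      (forall K : set T, compact K -> mu K < +oo) &
      mu [set: T] != 0].

Definition improper mu : Prop := radon mu /\ mu [set: T] = +oo.

End radon.

Section qvague.
Context {R : realType} {T : pmetricType R}.

Definition CK : set (T -> R) :=
  [set f | continuous f /\ compact (closure [set x | f x != 0])].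

(* Rintegral truncates infinite integrals to 0; this does not occur here,
   functions in CK being integrable against any Radon measure. *)
Definition qvague_cvg (mu_ : nat -> {measure set (borel T) -> \bar R})
    (mu : {measure set (borel T) -> \bar R}) : Prop :=
  [/\ forall n, radon (mu_ n), radon mu &
      exists2 a : nat -> R, (forall n, 0 < a n) &
        forall f, CK f ->
          a n * \int[mu_ n]_x f x @[n --> \oo] --> \int[mu]_x f x].

End qvague.

Section bounded_measurable.
Context {d : measure_display} {T : measurableType d} {R : realType}.

Definition bmfun : {pred T -> R} :=
  fun f => `[< measurable_fun [set: T] f /\ bounded_fun f >].

Lemma bmfun_submod_closed : submod_closed bmfun.
Proof.
split.
  apply/asboolP; split; first exact: measurable_cst.
  by exists 0; split => // x x0 t _ /=; rewrite normr0 ltW.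
move=> a f g /asboolP[mf [M [Mr fM]]] /asboolP[mg [N [Nr gN]]].
apply/asboolP; split.
  apply: measurable_funD => //.
  by apply: measurable_funM => //; exact: measurable_cst.
exists (`|a| * (`|M| + 1) + (`|N| + 1)); split=> [|B ltB t _ /=].
  by rewrite num_real.
have Mt : `|f t| <= `|M| + 1.
  by apply: fM => //; rewrite (le_lt_trans (ler_norm _))// ltrDl.
have Nt : `|g t| <= `|N| + 1.
  by apply: gN => //; rewrite (le_lt_trans (ler_norm _))// ltrDl.
rewrite (le_trans _ (ltW ltB))// (le_trans (ler_normD _ _))//.
by rewrite lerD// normrM ler_wpM2l.
Qed.

HB.instance Definition _ := GRing.isSubmodClosed.Build R (T -> R) bmfun
  bmfun_submod_closed.

End bounded_measurable.
Arguments bmfun {d} T R.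

Record Fb d (T : measurableType d) (R : realType) :=
  MkFb { Fb_fun :> T -> R ; Fb_funP : Fb_fun \in bmfun T R }.
Arguments Fb {d} T R.

HB.instance Definition _ d (T : measurableType d) (R : realType) :=
  [isSub for @Fb_fun d T R].
HB.instance Definition _ d (T : measurableType d) (R : realType) :=
  [Choice of Fb T R by <:].
HB.instance Definition _ d (T : measurableType d) (R : realType) :=
  [SubChoice_isSubLmodule of Fb T R by <:].

Section fap.
Context {d : measure_display} {T : measurableType d} {R : realType}.

Lemma bmfun_cst (c : R) : cst c \in bmfun T R.
Proof.
apply/asboolP; split; first exact: measurable_cst.
by exists `|c|; split => [|x cx t _ /=]; [rewrite num_real|exact: ltW].
Qed.

Definition Fb_cst (c : R) : Fb T R := MkFb (bmfun_cst c).

Record FAP := MkFAP {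
  FAP_fun :> {scalar Fb T R} ;
  FAP_ge0 : forall f : Fb T R, (forall x, 0 <= f x) -> 0 <= FAP_fun f ;
  FAP_1 : FAP_fun (Fb_cst 1) = 1 }.

Definition fap_limit_points (pi_ : nat -> FAP) : set FAP :=
  [set p | forall (k : nat) (f : 'I_k -> Fb T R) (eps : R),
    (0 < k)%N -> 0 < eps ->
    forall N, exists2 n, (N <= n)%N &
      forall i, `|pi_ n (f i) - p (f i)| <= eps].

Section fap_of_probability.
Variable P : probability T R.

Definition prob_fun (f : Fb T R) : R := \int[P]_x f x.

Lemma Fb_integrable (f : Fb T R) : P.-integrable [set: T] (EFin \o f).
Proof.
case: f => f /= /asboolP[mf bf].
apply: measurable_bounded_integrable => //.
by rewrite (le_lt_trans (probability_le1 _ _))// ltry.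
Qed.

Lemma prob_fun_linear : linear_for *%R prob_fun.
Proof.
move=> a f g; rewrite /prob_fun.
rewrite -RintegralZl//; last exact: Fb_integrable.
rewrite -RintegralD//; last exact: Fb_integrable.
exact: (Fb_integrable (a *: f)).
Qed.

HB.instance Definition _ :=
  GRing.isLinear.Build R (Fb T R) R *%R prob_fun prob_fun_linear.

Lemma prob_fun_ge0 (f : Fb T R) : (forall x, 0 <= f x) -> 0 <= prob_fun f.
Proof. by move=> f0; exact: Rintegral_ge0. Qed.

Lemma prob_fun_1 : prob_fun (Fb_cst 1) = 1.
Proof.
rewrite /prob_fun Rintegral_cst// mul1r.
by have /(congr1 fine) := probability_setT P.
Qed.

Definition prob_FAP : FAP := @MkFAP prob_fun prob_fun_ge0 prob_fun_1.

End fap_of_probability.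
End fap.
Arguments FAP {d} T R.

(* Main.v *)
(* Since [pi1] has infinite mass, the scalars of its q-vague convergence tend to
   infinity, so [pi_ n] loses all its mass on each compact set. Hence for an
   exhaustion [K] of the space by compact sets and some slowly growing [k],
   [pi_ n (K (k n))] still tends to 0. Scale [pi_ n] by [1 - 1 / (n + 1)] off
   [K (k n)] and replace it on [K (k n)] by the multiple of [pi2] of the missing
   mass [w n > 0]. This changes integrals of functions bounded by [M] by at most
   [2 * M * w n], which tends to 0, so the FAP limit points are the same. The new
   probability is exactly proportional to [pi2] on [K (k n)], and every function
   with compact support eventually lives there. *)
Require Import Defs.
From HB Require Import structures.
From mathcomp Require Import all_boot all_order all_algebra.
From mathcomp Require Import all_classical all_reals all_analysis.
From mathcomp Require Import measurable_realfun.
From mathcomp Require Import ring lra.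

Set Implicit Arguments.
Unset Strict Implicit.
Unset Printing Implicit Defensive.

Import Order.TTheory GRing.Theory Num.Theory.
Import numFieldNormedType.Exports.

Local Open Scope classical_set_scope.
Local Open Scope ring_scope.

(** * Exhaustions and cutoff functions in locally compact separable metric spaces *)

Section topology.
Context {R : realType} {T : pmetricType R}.

Lemma separable_nat_dense : separable_space T ->
  exists f : nat -> T, dense (range f).
Proof.
move=> [D /countable_injP[g gD] dD].
exists (fun n => xget point [set d | D d /\ g d = n]).
move=> U U0 oU; have [x [Ux Dx]] := dD U U0 oU; exists x; split => //.
exists (g x) => //=; case: xgetP => [y -> [Dy gy]|/(_ x)/= []//].
by apply: gD; rewrite ?inE.
Qed.

(** Balls with centres in a countable dense set and radii [1 / (j + 1)] are kept when they are
    relatively compact. By local compactness the interiors of the kept balls cover the space, and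
    the finite unions of them over [i, j < n] increase with [n]. *)
Lemma locally_compact_open_exhaustion :
  locally_compact [set: T] -> separable_space T ->
  exists U : nat -> set T, [/\ forall n, open (U n),
    forall n, compact (closure (U n)),
    {homo U : m n / (m <= n)%N >-> m `<=` n} &
    forall x, exists n, U n x].
Proof.
move=> lcT /separable_nat_dense[f df].
pose V i j : set T := if pselect (precompact (ball (f i) (j.+1%:R^-1 : R)))
  then (ball (f i) (j.+1%:R^-1 : R))° else set0.
have oV i j : open (V i j).
  by rewrite /V; case: pselect => ?; [exact: open_interior|exact: open0].
have cV i j : precompact (V i j).
  rewrite /V; case: pselect => [c|?].
    exact: precompact_subset (@interior_subset _ _) c.
  by exists set0 => //; split; [exact: compact0|exact: closed0].
pose U n :=
  \bigcup_(p in [set p : nat * nat | (p.1 < n)%N /\ (p.2 < n)%N]) V p.1 p.2.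
exists U; split.
- by move=> n; apply: bigcup_open => p _; exact: oV.
- move=> n; rewrite -precompactE.
  pose W := \big[setU/set0]_(i < n) \big[setU/set0]_(j < n) closure (V i j).
  have cW : compact W.
    apply: bigsetU_compact => i _; apply: bigsetU_compact => j _.
    by rewrite -precompactE.
  exists W; last first.
    by split => //; exact: compact_closed (metric_hausdorff (T := T)) cW.
  move=> x [[i j] /= [ilt jlt] Vx].
  rewrite /W (bigD1 (Ordinal ilt))//= ; left.
  by rewrite (bigD1 (Ordinal jlt))//=; left; exact: subset_closure.
- move=> m n mn x [[i j] /= [im jm] Vx]; exists (i, j) => //=.
  by split; [exact: leq_trans im mn|exact: leq_trans jm mn].
- move=> x.
  have := lcT x I; rewrite withinET => -[B xB pB].
  have [e /= e0 eB] : exists2 e : R, 0 < e & ball x e `<=` B.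
    by move: xB; rewrite -nbhs_ballE => -[e e0 ?]; exists e.
  have [j _ /(_ j (leqnn j))/= je] :=
    near_infty_natSinv_lt (PosNum (divr_gt0 e0 (ltr0n R 2))).
  set r := j.+1%:R^-1 in je.
  have r0 : 0 < r by rewrite invr_gt0.
  have r20 : 0 < r / 2 by rewrite divr_gt0.
  (* With a centre [y] within [r / 2] of [x], the ball of radius [r] at [y] contains that of radius
     [r / 2] at [x], and lies in that of radius [r / 2 + r < e] at [x], hence in the relatively
     compact [B]. *)
  have [y [xy [i _ iy]]] : (ball x (r / 2))° `&` range f !=set0.
    by apply: df; [exists x; exact: nbhsx_ballx|exact: open_interior].
  have {}xy : ball y (r / 2) x by apply: ball_sym; exact: interior_subset xy.
  have Vx : V i j x.
    rewrite /V iy -/r; case: pselect => [?|]; last first.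
      case; exists B => // z yz; apply: eB.
      apply: (@le_ball _ _ _ (r / 2 + r)); first lra.
      by apply: ball_triangle yz; exact: ball_sym.
    apply: filterS (nbhsx_ballx x _ r20) => z xz.
    by rewrite (splitr r); exact: ball_triangle xz.
  exists (maxn i j).+1, (i, j) => //=.
  by rewrite !ltnS leq_maxl leq_maxr.
Qed.

Context (lcT : locally_compact [set: T]) (sT : separable_space T).

Lemma compact_sub_open_exhaustion (U : nat -> set T) (C : set T) :
  (forall n, open (U n)) -> {homo U : m n / (m <= n)%N >-> m `<=` n} ->
  (forall x, exists n, U n x) -> compact C -> exists n, C `<=` U n.
Proof.
move=> oU Umono Ucover; rewrite compact_cover => /(_ nat setT U).
case=> [//|x _|D _ CD]; first by have [n] := Ucover x; exists n.
exists (\max_(i <- finmap.enum_fset D) i)%N => x /CD[i /= iD].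
by apply: Umono; exact: leq_bigmax_seq.
Qed.

(** A Urysohn function separating [C] from the complement of some [U n] containing [C]: its support
    lies in the compact closure of [U n]. *)
Lemma CK_cutoff (C : set T) : compact C -> exists f : T -> R,
  [/\ CK f, forall x, 0 <= f x <= 1 & forall x, C x -> f x = 1].
Proof.
move=> cC.
have [U [oU cU Umono Ucover]] := locally_compact_open_exhaustion lcT sT.
have [n Cn] := compact_sub_open_exhaustion oU Umono Ucover cC.
have sep : uniform_separator (~` U n) C.
  have /normal_separatorP sep := @pseudometric_normal R T.
  apply: (sep R _ _ (open_closedC (oU n))).
    exact: compact_closed (metric_hausdorff (T := T)) cC.
  by apply/disjoints_subset; exact: subsetC.
pose f : T -> R := Urysohn (~` U n) C.
exists f; split.
- split; first exact: Urysohn_continuous.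
  rewrite -precompactE; apply: (precompact_subset (B := U n)).
    move=> x /= fx; apply: contrapT => Ux; move/eqP: fx; apply.
    by apply: (Urysohn_sub0 sep); exists x.
  by rewrite precompactE.
- move=> x; have /= := @Urysohn_range T R (~` U n) C (f x).
  by rewrite in_itv/=; apply; exists x.
- by move=> x Cx; apply: (Urysohn_sub1 sep); exists x.
Qed.
End topology.

(** * Replacing a probability on a set by a multiple of another measure *)

Section splice.
Context {d : measure_display} {T : measurableType d} {R : realType}.
Implicit Types (P Q : probability T R) (mu nu : {measure set T -> \bar R}).

(* The mass to be put on [K] for the total mass to be 1; it is positive for
   [a < 1] even when [P K = 0]. *)
Definition splice_weight P (K : set T) (a : R) : R := 1 - a * fine (P (~` K)).

(* [v] stands for [nu K]. *)
Definition splice P nu (K : set T) (a v : R) Q : Prop :=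
  forall A, measurable A ->
    Q A = (a%:E * P (A `\` K) + (splice_weight P K a / v)%:E * nu (A `&` K))%E.

Lemma fine_probability_le1 P A : measurable A -> fine (P A) <= 1.
Proof.
by move=> mA; rewrite -lee_fin fineK ?fin_num_measure// probability_le1.
Qed.

Lemma splice_weight_ge P (K : set T) (a : R) : 0 <= a -> measurable K ->
  1 - a <= splice_weight P K a.
Proof.
move=> a0 mK; rewrite lerD2l lerN2 ler_piMr//.
by apply: fine_probability_le1; exact: measurableC.
Qed.

Lemma splice_weight_ge0 P (K : set T) (a : R) : 0 <= a <= 1 -> measurable K ->
  0 <= splice_weight P K a.
Proof.
move=> /andP[a0 a1] mK; rewrite (le_trans _ (splice_weight_ge P a0 mK))//.
by rewrite subr_ge0.
Qed.

Lemma splice_exists P nu (K : set T) (a v : R) : measurable K -> nu K = v%:E ->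
  0 < v -> 0 <= a <= 1 -> exists Q, splice P nu K a v Q.
Proof.
move=> mK nuK v0 a01; have /andP[a0 a1] := a01.
have c0 : 0 <= splice_weight P K a / v.
  by rewrite divr_ge0 ?(ltW v0)// splice_weight_ge0.
have mKc : measurable (~` K) by exact: measurableC.
pose m0 : {measure set T -> \bar R} := mscale (NngNum a0) (mrestr P mKc).
pose m1 : {measure set T -> \bar R} := mscale (NngNum c0) (mrestr nu mK).
pose m : {measure set T -> \bar R} :=
  msum (fun n => if n is 0%N then m0 else m1) 2.
have mE A : m A = (a%:E * P (A `\` K)
    + (splice_weight P K a / v)%:E * nu (A `&` K))%E.
  exact: (measure_addE m0 m1).
have mT : m setT = 1%E.
  rewrite mE setTD setTI nuK -[P _]fineK ?fin_num_measure//.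
  rewrite -!EFinM -EFinD divfK ?gt_eqF//.
  by congr EFin; rewrite /splice_weight addrC subrK.
pose Pm := Measure_isProbability.Build _ _ _ m mT.
pose Q : probability T R := HB.pack (m : set T -> \bar R) m Pm.
by exists Q => A mA; rewrite -mE.
Qed.

(** Scaling is applied to the positive and negative parts separately; integrability makes both
    finite, so that their difference can be scaled too. *)
Lemma Rintegral_eq_mscale mu nu (D : set T) (k : R) (f : T -> R) :
  measurable D -> 0 <= k ->
  (forall A, measurable A -> A `<=` D -> mu A = (k%:E * nu A)%E) ->
  nu.-integrable D (EFin \o f) ->
  \int[mu]_(x in D) f x = k * \int[nu]_(x in D) f x.
Proof.
move=> mD k0 mu_nu intf.
have mf : measurable_fun D (EFin \o f) by exact: measurable_int intf.
rewrite /Rintegral (@eq_measure_integral _ _ _ _ (mscale (NngNum k0) nu))//.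
rewrite integralE [X in _ = _ * fine X]integralE.
rewrite !ge0_integral_mscale//; last 2 first.
- exact: measurable_funeneg.
- exact: measurable_funepos.
rewrite -muleBr//; last first.
  by apply: fin_num_adde_defl; rewrite fin_numN; exact: integrable_neg_fin_num.
rewrite fineM// fin_numB integrable_pos_fin_num ?integrable_neg_fin_num//.
Qed.

Lemma normr_Rintegral_le mu (D : set T) (f : T -> R) (M : R) :
  measurable D -> (mu D < +oo)%E -> mu.-integrable D (EFin \o f) ->
  (forall x, `|f x| <= M) -> `|\int[mu]_(x in D) f x| <= M * fine (mu D).
Proof.
move=> mD muD intf fM; rewrite (le_trans (le_normr_Rintegral _ _))//.
rewrite -Rintegral_cst//; apply: le_Rintegral => //.
  exact: integrable_norm.
apply: (@measurable_bounded_integrable _ _ _ _ (cst M)) => //.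
exact: bounded_cst.
Qed.

Section splice_theory.
Context P nu (K : set T) (a v : R) Q.
Hypotheses (mK : measurable K) (nuK : nu K = v%:E) (v0 : 0 < v).
Hypotheses (a01 : 0 <= a <= 1) (QE : splice P nu K a v Q).

Let mKc : measurable (~` K). Proof. exact: measurableC. Qed.

Lemma Fb_integrable_in mu (D : set T) (f : Fb T R) :
  measurable D -> (mu D < +oo)%E -> mu.-integrable D (EFin \o f).
Proof.
move=> mD muD.
have /asboolP[mf [M [Mr Mf]]] := Fb_funP f.
apply: measurable_bounded_integrable => //.
  exact: measurable_funTS.
by exists M; split => // x Mx y _; exact: Mf.
Qed.

Lemma splice_Rintegral (f : Fb T R) :
  \int[Q]_x f x = a * \int[P]_(x in ~` K) f x
    + splice_weight P K a / v * \int[nu]_(x in K) f x.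
Proof.
have /andP[a0 a1] := a01.
rewrite -(setvU K) Rintegral_setU//; last 2 first.
- by rewrite setvU; exact: Fb_integrable.
- by apply/disj_set2P; rewrite setICl.
congr (_ + _).
  apply: Rintegral_eq_mscale => //.
    move=> A mA AK; apply: (etrans (QE mA)).
    rewrite (_ : A `&` K = set0) ?measure0 ?mule0 ?adde0; last first.
      by apply/disjoints_subset.
    by rewrite setDE setIidl.
  by apply: Fb_integrable_in => //; rewrite -ge0_fin_numE ?fin_num_measure.
apply: Rintegral_eq_mscale => //.
- by rewrite divr_ge0 ?(ltW v0)// splice_weight_ge0.
- move=> A mA AK; apply: (etrans (QE mA)).
  rewrite (_ : A `\` K = set0) ?measure0 ?mule0 ?add0e; last first.
    by rewrite setD_eq0.
  by rewrite setIidl.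
- by apply: Fb_integrable_in => //; rewrite nuK ltry.
Qed.

(** Off [K] the two measures differ by the factor [1 - a]; on [K] the two integrals are bounded
    separately, by [M] times the respective masses. *)
Lemma splice_dist (f : Fb T R) (M : R) : (forall x, `|f x| <= M) ->
  `|\int[Q]_x f x - \int[P]_x f x| <= 2 * M * splice_weight P K a.
Proof.
move=> fM; have /andP[a0 a1] := a01.
have w0 : 0 <= splice_weight P K a by exact: splice_weight_ge0.
have M0 : 0 <= M by exact: le_trans (fM point).
have PKc_fin : (P (~` K) < +oo)%E by rewrite -ge0_fin_numE ?fin_num_measure.
have PK_fin : (P K < +oo)%E by rewrite -ge0_fin_numE ?fin_num_measure.
have nuK_fin : (nu K < +oo)%E by rewrite nuK ltry.
rewrite splice_Rintegral.
have -> : \int[P]_x f x = \int[P]_(x in ~` K) f x + \int[P]_(x in K) f x.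
  rewrite -Rintegral_setU ?setvU//; first exact: Fb_integrable.
  by apply/disj_set2P; rewrite setICl.
have IP1 := normr_Rintegral_le mKc PKc_fin (Fb_integrable_in f mKc PKc_fin) fM.
have IP2 := normr_Rintegral_le mK PK_fin (Fb_integrable_in f mK PK_fin) fM.
have := normr_Rintegral_le mK nuK_fin (Fb_integrable_in f mK nuK_fin) fM.
rewrite nuK/= => IN0.
have PKE : fine (P K) = 1 - fine (P (~` K)).
  by rewrite -[K in LHS]setCK probability_setC// fineB// fin_num_measure.
rewrite PKE in IP2.
set IN := \int[nu]_(x in K) f x in IN0 *.
set IA := \int[P]_(x in ~` K) f x in IP1 *.
set IB := \int[P]_(x in K) f x in IP2 *.
have {}IN0 : `|splice_weight P K a / v * IN| <= M * splice_weight P K a.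
  have c0 : 0 <= splice_weight P K a / v by rewrite divr_ge0// ltW.
  rewrite normrM ger0_norm// (le_trans (ler_wpM2l c0 IN0))//.
  rewrite (_ : _ * (M * v) = M * splice_weight P K a)//.
  by field; rewrite gt_eqF.
have {}IP1 : `|(1 - a) * IA| <= (1 - a) * (M * fine (P (~` K))).
  by rewrite normrM ger0_norm ?subr_ge0// ler_wpM2l// subr_ge0.
rewrite (_ : _ - _ = splice_weight P K a / v * IN - (1 - a) * IA - IB);
  last by ring.
rewrite (le_trans (ler_normB _ _))//.
rewrite (le_trans (lerD (ler_normB _ _) (lexx _)))//.
rewrite (le_trans (lerD (lerD IN0 IP1) IP2))// /splice_weight.
by rewrite le_eqVlt; apply/orP; left; apply/eqP; ring.
Qed.

End splice_theory.
End splice.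

(** * Regularity of Borel measures and of splices *)

Section radon_theory.
Context {R : realType} {T : pmetricType R}.

Lemma borel_open (U : set (borel T)) : open (U : set T) -> measurable U.
Proof. by move=> oU; apply: sub_sigma_algebra. Qed.

Lemma borel_compact (K : set (borel T)) : compact (K : set T) -> measurable K.
Proof.
move=> cK; rewrite -[K]setCK; apply: measurableC; apply: borel_open.
exact: closed_openC (compact_closed (metric_hausdorff (T := T)) cK).
Qed.

Lemma CK_bmfun (f : T -> R) : CK f -> (f : borel T -> R) \in bmfun (borel T) R.
Proof.
move=> [cf cK]; apply/asboolP; split.
  apply: (measurability _ (RGenOpens.measurableE R)).
  move=> _ [_ [a [b ->]] <-]; rewrite setTI; apply: borel_open.
  by apply: open_comp; [move=> x _; exact: cf|exact: interval_open].
have [M [Mr Mf]] : bounded_set (f @` closure [set x | f x != 0]).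
  apply: compact_bounded; apply: continuous_compact => //.
  exact: continuous_subspaceT.
(* [M] bounds [f] only on the support and may be negative if the support is empty; the maximum with
   0 covers the points where [f] vanishes. *)
exists (Num.max M 0); split; first by rewrite num_real.
move=> x; rewrite gt_max => /andP[Mx x0] t _ /=.
have [->|ft0] := eqVneq (f t) 0; first by rewrite normr0 ltW.
by apply: Mf => //; exists t => //; exact: subset_closure.
Qed.

Definition CK_Fb (f : T -> R) (fK : CK f) : Fb (borel T) R :=
  MkFb (CK_bmfun fK).

Implicit Types (mu nu : {measure set (borel T) -> \bar R}).
Implicit Types (P Q : probability (borel T) R).

Lemma inner_regular_adherent mu (A : set T) (v e : R) : inner_regular mu A ->
  mu A = v%:E -> 0 < e ->
  exists K, [/\ compact K, K `<=` A & ((v - e)%:E < mu K)%E].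
Proof.
move=> rA muA e0.
have [|_ [K [cK KA] <-] vK] := ub_ereal_sup_adherent e0
  (S := [set mu K | K in [set K : set T | compact K /\ K `<=` A]]).
  by rewrite -rA muA.
by exists K; split => //; move: vK; rewrite -rA muA.
Qed.

Lemma inner_regularP mu (A : set (borel T)) (v : R) : measurable A ->
  mu A = v%:E ->
  (forall e : R, 0 < e ->
    exists K : set T, [/\ compact K, K `<=` A & ((v - e)%:E <= mu K)%E]) ->
  inner_regular mu A.
Proof.
move=> mA muA h; apply/eqP; rewrite eq_le; apply/andP; split.
  apply/lee_addgt0Pr => e /h[K [cK KA vK]].
  rewrite muA -leeBlDr// -EFinB (le_trans vK)//.
  by apply: ereal_sup_ubound; exists K.
apply: ge_ereal_sup => _ [K [cK KA] <-].
by apply: le_measure => //; rewrite inE//; exact: borel_compact.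
Qed.

(** Outer regularity follows by complements: if a compact [K] nearly fills [~]
    A[, then the open set]~[K] contains [A] and, the total mass being finite, has nearly the same
    measure. *)
Lemma finite_inner_regular mu : (mu [set: borel T] < +oo)%E ->
  (forall A : set (borel T), measurable A -> inner_regular mu A) ->
  regular_measure mu.
Proof.
move=> muT imu A mA; split; last exact: imu.
have fin B : measurable B -> mu B = (fine (mu B))%:E.
  move=> mB; rewrite fineK// ge0_fin_numE// (le_lt_trans _ muT)//.
  by apply: le_measure; rewrite ?inE.
have setCE B : measurable B -> mu (~` B) = (fine (mu setT) - fine (mu B))%:E.
  by move=> mB; rewrite -setTD measureD// setTI EFinB -!fin.
apply/eqP; rewrite eq_le; apply/andP; split.
  apply: le_ereal_inf_tmp => _ [U [oU AU] <-].
  by apply: le_measure => //; rewrite inE//; exact: borel_open.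
apply/lee_addgt0Pr => e e0.
have mAc : measurable (~` A) by exact: measurableC.
have [K [cK KA vK]] := inner_regular_adherent (imu _ mAc) (setCE _ mA) e0.
have mK := borel_compact cK.
apply: (@le_trans _ _ (mu (~` K))).
  apply: ereal_inf_lbound; exists (~` K) => //; split.
    exact: closed_openC (compact_closed (metric_hausdorff (T := T)) cK).
  exact: subsetCr.
move: vK; rewrite setCE// (fin K)// (fin A)// -EFinD lte_fin lee_fin; lra.
Qed.

Lemma probability_radon Q :
  (forall A : set (borel T), measurable A -> inner_regular Q A) -> radon Q.
Proof.
move=> iQ.
have QT : (Q [set: borel T] < +oo)%E by rewrite probability_setT ltry.
split; first exact: finite_inner_regular.
  move=> K cK; apply: le_lt_trans QT; apply: le_measure; rewrite ?inE//.
  exact: borel_compact.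
apply/eqP => QT0; have := etrans (esym (probability_setT Q)) QT0.
by move/eqP; rewrite onee_eq0.
Qed.

(** A compact set approximating [A] is the union of one inside [A]\[K] for [P] and one inside
    [A]&[K] for [nu]. *)
Lemma splice_radon P nu (K : set T) (a v : R) Q :
  radon P -> radon nu -> compact K -> nu K = v%:E -> 0 < v -> 0 <= a <= 1 ->
  splice P nu K a v Q -> radon Q.
Proof.
move=> [rP _ _] [rnu _ _] cK nuK v0 a01 QE.
have /andP[a0 a1] := a01.
apply: probability_radon => A mA.
have mK := borel_compact cK.
have c0 : 0 <= splice_weight P K a / v.
  by rewrite divr_ge0 ?(ltW v0)// splice_weight_ge0.
set c := splice_weight P K a / v in c0 *.
have mAK : measurable (A `&` K) by exact: measurableI.
have mAD : measurable (A `\` K) by exact: measurableD.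
have PAE : P (A `\` K) = (fine (P (A `\` K)))%:E.
  by rewrite fineK ?fin_num_measure.
have nuAE : nu (A `&` K) = (fine (nu (A `&` K)))%:E.
  rewrite fineK// ge0_fin_numE//.
  apply: (@le_lt_trans _ _ (nu K)); last by rewrite nuK ltry.
  by apply: le_measure; rewrite ?inE//; exact: subIsetr.
apply: (inner_regularP mA
  (v := a * fine (P (A `\` K)) + c * fine (nu (A `&` K)))).
  by apply: (etrans (QE _ mA)); rewrite PAE nuAE.
move=> e e0.
(* The two errors enter with coefficients [a <= 1] and [c], so a tolerance of [e / (1 + c)] for each
   gives at most [e] in all. *)
have e'0 : 0 < e / (1 + c) by rewrite divr_gt0// ltr_pwDl.
have [C1 [cC1 C1A PC1]] := inner_regular_adherent (rP _ mAD).2 PAE e'0.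
have [C2 [cC2 C2A nuC2]] := inner_regular_adherent (rnu _ mAK).2 nuAE e'0.
exists (C1 `|` C2); split; first exact: compactU.
  by rewrite subUset; split => x; [move=> /C1A[]|move=> /C2A[]].
have mC : measurable (C1 `|` C2 : set (borel T)).
  by apply: borel_compact; exact: compactU.
apply: le_trans (_ : _ <= Q (C1 `|` C2))%E => //.
rewrite (QE _ mC).
apply: (@le_trans _ _ (a%:E * (fine (P (A `\` K)) - e / (1 + c))%:E +
  c%:E * (fine (nu (A `&` K)) - e / (1 + c))%:E)%E).
  rewrite -!EFinM -EFinD lee_fin !mulrBr addrACA lerD2l.
  rewrite -opprD lerN2 -mulrDl mulrA ler_pdivrMr ?ltr_pwDl//.
  by rewrite mulrC ler_wpM2l ?(ltW e0)// lerD2r.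
apply: leeD; apply: lee_wpmul2l => //.
  apply: (le_trans (ltW PC1)); apply: le_measure; rewrite ?inE//.
  - exact: borel_compact.
  - by apply: measurableD.
  - by move=> x Cx; split; [left|have [] := C1A _ Cx].
apply: (le_trans (ltW nuC2)); apply: le_measure; rewrite ?inE//.
- exact: borel_compact.
- exact: measurableI.
- by move=> x Cx; split; [right|have [] := C2A _ Cx].
Qed.
End radon_theory.

(** * Escape of mass from compact sets *)

Section escape.
Context {R : realType} {T : pmetricType R}.
Implicit Types (mu nu : {measure set (borel T) -> \bar R}).
Implicit Types (P Q : probability (borel T) R).

Lemma CK_out (f : T -> R) (x : T) : ~ closure [set x | f x != 0] x -> f x = 0.
Proof.
move=> fx; apply: contra_notP fx => /eqP fx; exact: subset_closure.
Qed.

Lemma CK_patch (f : T -> R) (K : set T) :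
  closure [set x | f x != 0] `<=` K -> f \_ K = f.
Proof.
move=> fK; apply/funext => x; rewrite patchE; case: ifPn => // /negP.
by rewrite inE => Kx; rewrite CK_out// => /fK.
Qed.

(** The total mass may be infinite, so the integral is first restricted to the compact support,
    where a bounded function is integrable. *)
Lemma CK_integrable mu (f : T -> R) : radon mu -> CK f ->
  mu.-integrable [set: borel T] (EFin \o f).
Proof.
move=> [_ mufin _] fK; have [_ cS] := fK.
have <- : (EFin \o f) \_ (closure [set x | f x != 0]) = EFin \o f.
  by rewrite restrict_EFin CK_patch.
have mS : measurable (closure [set x | f x != 0] : set (borel T)).
  exact: borel_compact.
rewrite -integrable_mkcond//.
exact: (Fb_integrable_in (CK_Fb fK) mS (mufin _ cS)).
Qed.

Lemma le_CK_Rintegral mu (f : T -> R) (K : set T) : radon mu -> CK f ->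
  compact K -> (forall x, 0 <= f x) -> (forall x, K x -> f x = 1) ->
  fine (mu K) <= \int[mu]_x f x.
Proof.
move=> rmu fK cK f0 f1.
have mK := borel_compact cK.
have muK : (mu K < +oo)%E by case: rmu => _ /(_ _ cK).
have -> : fine (mu K) = \int[mu]_x (\1_K x : R).
  by rewrite /Rintegral integral_indic ?setIT.
apply: le_Rintegral => //.
- rewrite (_ : EFin \o _ =
      (EFin \o (Fb_cst 1 : Fb (borel T) R)) \_ (K : set (borel T))).
    by rewrite -integrable_mkcond//; exact: Fb_integrable_in.
  by apply/funext => x/=; rewrite indic_restrict restrict_EFin.
- exact: CK_integrable.
- move=> x _; rewrite indicE; case: (boolP (x \in K)) => //; rewrite inE => Kx.
  by rewrite f1.
Qed.

Hypotheses (lcT : locally_compact [set: T]) (sT : separable_space T).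

Lemma improper_compact_gt mu (M : R) : improper mu ->
  exists2 K : set T, compact K & (M%:E < mu K)%E.
Proof.
move=> [[rmu _ _] muT].
have [_ iT] := rmu setT measurableT.
have : (M%:E < mu setT)%E by rewrite muT ltry.
by rewrite iT => /ereal_sup_gt[_ [K [cK _] <-] MK]; exists K.
Qed.

Section sequence.
Context (P_ : nat -> probability (borel T) R).
Context (mu : {measure set (borel T) -> \bar R}).
Context (a : nat -> R).
Hypotheses (rP : forall n, radon (P_ n)) (imu : improper mu).
Hypothesis (a0 : forall n, 0 < a n).
Hypothesis Pmu : forall f, CK f ->
  a n * \int[P_ n]_x f x @[n --> \oo] --> \int[mu]_x f x.

(** For a cutoff [f <= 1] of a compact set of [mu]-mass above [M], the integrals against [P_ n] are
    at most 1, so [a n] dominates a sequence whose limit exceeds [M]. *)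
Lemma scale_dvg (M : R) : \forall n \near \oo, M < a n.
Proof.
have [K cK MK] := improper_compact_gt M imu.
have [f [fK f01 f1]] := CK_cutoff lcT sT cK.
have f0 x : 0 <= f x by case/andP: (f01 x).
have [rmu _] := imu.
have MI : M < \int[mu]_x f x.
  apply: lt_le_trans (le_CK_Rintegral rmu fK cK f0 f1).
  rewrite -lte_fin fineK// ge0_fin_numE//; by case: rmu => _ /(_ _ cK).
apply: filterS (cvgr_gt _ (Pmu fK) _ MI) => n MaI; apply: lt_le_trans MaI _.
rewrite ler_piMr ?(ltW (a0 n))//.
have <- : \int[P_ n]_x (cst 1 x) = 1 :> R.
  rewrite Rintegral_cst// mul1r.
  by have /(congr1 fine) := probability_setT (P_ n).
apply: le_Rintegral => //.
- exact: CK_integrable.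
- exact: (Fb_integrable (P_ n) (Fb_cst 1)).
- by move=> x _; case/andP: (f01 x).
Qed.

(** For a cutoff [f] of [K], the products of [a n] with the integrals of [f] stay bounded while
    [a n] diverges, so these integrals, which dominate [P_ n K], tend to 0. *)
Lemma compact_mass_escape (K : set T) (e : R) : compact K -> 0 < e ->
  \forall n \near \oo, fine (P_ n K) <= e.
Proof.
move=> cK e0.
have [f [fK f01 f1]] := CK_cutoff lcT sT cK.
have f0 x : 0 <= f x by case/andP: (f01 x).
set L := \int[mu]_x f x.
have L1 : L < L + 1 by rewrite ltrDl.
near=> n.
apply: (le_trans (le_CK_Rintegral (rP n) fK cK f0 f1)).
have aL : a n * \int[P_ n]_x f x < L + 1.
  by near: n; exact: cvgr_lt _ (Pmu fK) _ L1.
have Lae : (L + 1) / e < a n by near: n; exact: scale_dvg.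
rewrite -(ler_pM2l (a0 n)) (le_trans (ltW aL))//.
by rewrite -ler_pdivrMr// ltW.
Unshelve. all: by end_near.
Qed.

End sequence.
End escape.

(** * Diagonal choice, comparison of FAP limit points, and the construction *)

Lemma diagonal_near (P : nat -> nat -> Prop) :
  (forall m, \forall n \near \oo, P m n) ->
  exists k : nat -> nat, (forall m, \forall n \near \oo, (m <= k n)%N) /\
    \forall n \near \oo, P (k n) n.
Proof.
move=> Pm.
have /choice[N NP] : forall m, exists N, forall n, (N <= n)%N -> P m n.
  by move=> m; have [N _ NP] := Pm m; exists N => n Nn; exact: NP.
(* [k n] is the largest [m <= n] whose threshold [N m] has been passed, and 0 by default if there is
   none. *)
exists (fun n => \max_(m < n.+1 | (N m <= n)%N) m)%N; split.
  move=> m; exists (maxn m (N m)) => // n /=; rewrite geq_max => /andP[mn Nn].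
  by rewrite (@leq_bigmax_cond _ (fun i : 'I_n.+1 => (N i <= n)%N) val
    (Ordinal (mn : (m < n.+1)%N))).
(* From [N 0] on the index 0 is admissible, so the maximum is attained at an admissible index. *)
exists (N 0) => // n /= Nn; apply: NP.
by have [|i Ni ->] := @eq_bigmax_cond _ (fun i : 'I_n.+1 => (N i <= n)%N) val;
  first by apply/card_gt0P; exists ord0.
Qed.

Lemma fap_limit_points_sub d (T : measurableType d) (R : realType)
    (p_ q_ : nat -> FAP T R) :
  (forall (f : Fb T R) (e : R), 0 < e ->
    \forall n \near \oo, `|p_ n f - q_ n f| <= e) ->
  fap_limit_points p_ `<=` fap_limit_points q_.
Proof.
move=> pq p pl k f e k0 e0 N.
have e20 : 0 < e / 2 by rewrite divr_gt0.
(* There are finitely many test functions, hence a common threshold. *)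
have [N' _ N'P] : \forall n \near \oo, forall i,
    `|p_ n (f i) - q_ n (f i)| <= e / 2.
  by apply: filter_forall => i; exact: pq.
have [n Nn pn] := pl k f (e / 2) k0 e20 (maxn N N').
move: Nn; rewrite geq_max => /andP[Nn N'n]; exists n => // i.
have := N'P _ N'n i; have := pn i; rewrite distrC => h1 h2.
rewrite distrC (le_trans (ler_distD (p_ n (f i)) _ _))//.
by rewrite (splitr e) lerD.
Qed.

Theorem corollary1 (R : realType) (Theta : pmetricType R)
    (Theta_lc : locally_compact [set: Theta])
    (Theta_sep : separable_space Theta)
    (pi_ : nat -> probability (borel Theta) R)
    (pi1 : {measure set (borel Theta) -> \bar R})
    (pi1_improper : improper pi1)
    (pi_cvg : qvague_cvg pi_ pi1)
    (pi2 : {measure set (borel Theta) -> \bar R})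
    (pi2_improper : improper pi2) :
  exists tpi_ : nat -> probability (borel Theta) R,
    qvague_cvg tpi_ pi2 /\
    fap_limit_points (fun n => prob_FAP (tpi_ n)) =
    fap_limit_points (fun n => prob_FAP (pi_ n)).
Proof.
have [rpi _ [a a0 api]] := pi_cvg.
have [rpi2 _] := pi2_improper.
have [U [oU cU Umono Ucover]] :=
  locally_compact_open_exhaustion Theta_lc Theta_sep.
have subU := compact_sub_open_exhaustion oU Umono Ucover.
(* Starting the exhaustion at an index [m0] with [K0] inside [U m0] gives every [K m] positive
   [pi2]-mass, so that division by [v m] is legitimate. *)
have [K0 cK0 K0_gt0] := improper_compact_gt 0 pi2_improper.
have [m0 K0U] := subU _ cK0.
pose K m : set (borel Theta) := closure (U (m0 + m)%N).
have cK m : compact (K m : set Theta) by exact: cU.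
have mK m : measurable (K m) by exact: borel_compact.
pose v m := fine (pi2 (K m)).
have vE m : pi2 (K m) = (v m)%:E.
  by rewrite fineK// ge0_fin_numE//; case: rpi2 => _ /(_ _ (cK m)).
have v0 m : 0 < v m.
  rewrite -lte_fin -vE (lt_le_trans K0_gt0)//.
  apply: le_measure; rewrite ?inE//; first exact: borel_compact.
  apply: (subset_trans K0U); apply: (subset_trans (Umono _ _ (leq_addr m m0))).
  exact: subset_closure.
have [k [k_oo kP]] : exists k : nat -> nat,
    (forall m, \forall n \near \oo, (m <= k n)%N) /\
    \forall n \near \oo, fine (pi_ n (K (k n))) <= (k n).+1%:R^-1.
  apply: (diagonal_near (P := fun m n => fine (pi_ n (K m)) <= m.+1%:R^-1)).
  move=> m; apply: (compact_mass_escape Theta_lc Theta_sep rpi pi1_improper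
    a0 api (cK m)).
  by rewrite invr_gt0.
(* Being below 1, this factor ensures [w n >= 1 / (n + 1) > 0] even if [pi_ n] does not charge
   [K (k n)]; tending to 1, it lets [w n] vanish in the limit. *)
pose c n : R := 1 - n.+1%:R^-1.
have c01 n : 0 <= c n <= 1.
  by rewrite subr_ge0 invf_le1// ler1n/= lerBlDr lerDl invr_ge0.
pose w n := splice_weight (pi_ n) (K (k n)) (c n).
have w0 n : 0 < w n.
  have /andP[cn0 _] := c01 n.
  apply: lt_le_trans (splice_weight_ge (pi_ n) cn0 (mK (k n))).
  by rewrite /c subKr invr_gt0.
have /choice[tpi tpiE] : forall n, exists Q,
    splice (pi_ n) pi2 (K (k n)) (c n) (v (k n)) Q.
  by move=> n; exact: splice_exists.
have w_cvg0 (e : R) : 0 < e -> \forall n \near \oo, w n <= e.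
  move=> e0; have e20 : 0 < e / 2 by rewrite divr_gt0.
  have [m _ /(_ m (leqnn m))/= me] := near_infty_natSinv_lt (PosNum e20).
  near=> n.
  have nm : (m <= n)%N by near: n; exists m.
  have knm : (m <= k n)%N by near: n; exact: k_oo.
  have inv_le j : (m <= j)%N -> j.+1%:R^-1 <= e / 2 :> R.
    by move=> mj; apply: le_trans (ltW me); rewrite lef_pV2 ?posrE// ler_nat.
  have wE : w n = n.+1%:R^-1 + c n * fine (pi_ n (K (k n))).
    rewrite /w /splice_weight probability_setC// fineB ?fin_num_measure//=.
    by rewrite /c; ring.
  rewrite wE (splitr e) lerD ?inv_le//.
  have [cn0 cn1] := andP (c01 n).
  rewrite (le_trans (ler_piMl _ cn1))//; first by rewrite fine_ge0.
  by rewrite (le_trans _ (inv_le _ knm))//; near: n.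
exists tpi; split.
  split => //.
    move=> n.
    exact: (splice_radon (rpi n) rpi2 (cK _) (vE _) (v0 _) (c01 n) (tpiE n)).
  (* On [K (k n)] the measure [tpi n] is [w n / v (k n)] times [pi2]. The inverse scalars make the
     integral of [f] equal to its limit as soon as [K (k n)] contains the support. *)
  exists (fun n => v (k n) / w n); first by move=> n; rewrite divr_gt0.
  move=> f fK; have [_ cS] := fK; have [m Sm] := subU _ cS.
  apply: cvg_near_cst; near=> n.
  have SK : closure [set x | f x != 0] `<=` K (k n).
    apply: (subset_trans Sm); apply: (subset_trans _ (@subset_closure _ _)).
    apply: Umono; rewrite (@leq_trans (k n)) ?leq_addl//.
    by near: n; exact: k_oo.
  have := splice_Rintegral (mK _) (vE _) (v0 _) (c01 n) (tpiE n) (CK_Fb fK).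
  rewrite /= => ->.
  have -> : \int[pi_ n]_(x in ~` K (k n)) f x = 0.
    rewrite (@eq_Rintegral _ _ _ _ _ (cst 0)) ?Rintegral_cst ?mul0r//.
      exact: measurableC.
    by move=> x; rewrite inE => Kx; apply: CK_out => /SK.
  rewrite Rintegral_mkcond CK_patch// mulr0 add0r mulrA mulrA.
  by rewrite divfK ?gt_eqF// divff ?mul1r// gt_eqF.
have dist (f : Fb (borel Theta) R) (e : R) : 0 < e ->
    \forall n \near \oo, `|prob_FAP (tpi n) f - prob_FAP (pi_ n) f| <= e.
  move=> e0.
  have /asboolP[_ [M [_ Mf]]] := Fb_funP f.
  (* Boundedness gives a bound for each number strictly above [M]; this one is also positive, hence
     fit for the division below. *)
  have fM x : `|f x| <= `|M| + 1.
    by apply: Mf => //; rewrite (le_lt_trans (ler_norm _))// ltrDl.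
  have M0 : 0 < 2 * (`|M| + 1) by rewrite mulr_gt0// ltr_wpDl.
  near=> n.
  apply: (le_trans (splice_dist (mK _) (vE _) (v0 _) (c01 n) (tpiE n) fM)).
  rewrite mulrC -ler_pdivlMr//; near: n; apply: w_cvg0.
  by rewrite divr_gt0.
apply/seteqP; split; apply: fap_limit_points_sub => // f e e0.
by apply: filterS (dist f e e0) => n; rewrite distrC.
Unshelve. all: by end_near.
Qed.
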